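(* Let $\tilde f$ be a generic small perturbation of the elliptic umbilic $f(y_1,y_2)=\frac13y_1^3-y_1y_2^2$, and let $\widehat{\widetilde E}$ be its Morse homology bundle, glued across bifurcation lines by the isomorphisms induced by the transformation matrices. Then the holomorphic bundle $\widehat{\widetilde E}$ can be extended through the intersection points of bifurcation lines; i.e. for every intersection point $p$ of bifurcation lines, the composition of the gluing isomorphisms along a small simple loop around $p$ is the identity.
   Context: **Perturbation, caustic, bifurcation locus.** $\tilde f:\mathbb R^2\to\mathbb R$ is a generic small perturbation of $f$, equal to $f$ outside a compact set. For $x\in\mathbb R^2$ put $\tilde f_x(y)=\tilde f(y)-x\cdot y$ and consider the gradient system $dy/dt=\nabla\tilde f_x(y)$, whose solutions are called gradient lines. $\widetilde K$ (caustic) is the set of $x$ for which $\tilde f_x$ has a degenerate critical point. $\widetilde B$ (bifurcation locus) is the set of $x$ for which $\tilde f_x$ is Morse but $\nabla\tilde f_x$ is not Morse–Smale, i.e. some gradient line joins two saddles. Known facts, taken as given: $\widetilde K$ is a tricuspoid (closed curve with three cusps joined by three sides of folds). For $x$ inside $\widetilde K$, $\tilde f_x$ has four critical points when Morse: three saddles $s_1,s_2,s_3$ (index 1, labelled continuously) and a node $n$ (index 2). **The bundle.** For $x$ inside $\widetilde K$, $x\notin\widetilde B$, the incidence matrix is the column $I(x)\in\{0,1\}^3$ with $I(x)_i=1$ iff there is a gradient line from $n(x)$ to $s_i(x)$. It is constant on components of $\mathbb R^2\setminus(\widetilde K\cup\widetilde B)$. The Morse differential is $\partial_xn=\sum_iI(x)_is_i$,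 and the fibre of $\widehat{\widetilde E}$ over $x$ is the Morse homology $\big(\bigoplus_{i=1}^3\mathbb C[s_i(x)]\big)/\mathbb C\,\partial_xn$. Over each component the bundle is trivial with this fibre. Holomorphic sections over the dual torus fibration, with coordinates $(x,w)$, are obtained by multiplying constant sections by weights $\exp[2\pi(\frac{h(x)}2-\frac{A(x)}{4\pi}+i\frac{\partial h}{\partial x}\cdot w)]$, where $h$ is the local generating function (in base coordinates) of the corresponding sheet of the Lagrangian and $A$ is the connection form of the given flat $U(1)$-connection $d+A$. Gluings are defined on the unweighted sections, and the bundle is said to extend through $p$ when the composition of the gluings around $p$ is trivial. **Gluing along $\widetilde B$ inside $\widetilde K$.** For $i\ne j$ let $E_{ij}(\tau)$, $\tau\in\{1,0,-1\}$, be the $3\times3$ matrix with $1$ on the diagonal, $(i,j)$ entry $\tau$ and all other entries $0$. If $U,V$ are components inside $\widetilde K$ separated by a bifurcation line on which a non-generic gradient line from $s_i$ to $s_j$ appears, the transformation matrix from $U$ to $V$ is the matrix $E_{ji}(\tau)$ with $E_{ji}(\tau)I(U)=I(V)$. Thus $\tau=1$ if $I(U)_j=0\ne I(V)_j$, and $\tau=-1$ if $I(U)_j=1\neq I(V)_j$. The gluing isomorphism $\widehat{\widetilde E}(U)\cong\widehat{\widetilde E}(V)$ is the one induced by this matrix. **Classification of intersection points (known, taken as given).** Intersection points of bifurcation lines lie inside $\widetilde K$ and, up to relabelling the saddles and the choice of orientation of the loop, are of three types. (a) Two bifurcation lines cross, both characterized by the appearance of the same saddle-to-saddle separatrix (same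 pair of separatrices glued), so four branches leave $p$ and crossing consecutive branches alternately creates and destroys the same gradient line from $n$. (b) Two lines cross, one with a gradient line from $s_2$ to $s_1$, the other from $s_2$ to $s_3$; the four regions around $p$ have successive incidence matrices $(1,1,1),(0,1,1),(0,1,0),(1,1,0)$. (c) Five branches leave $p$, the successive regions having incidence matrices $(1,1,1),(0,1,1),(0,1,0),(0,1,0),(1,1,0)$, and the successive branches having gradient lines from $s_2$ to $s_1$, $s_2$ to $s_3$, $s_1$ to $s_3$, $s_2$ to $s_1$, $s_1$ to $s_3$. The third branch of type (c) is the only case with $I(U)=I(V)$. There $\tau$ is not determined by the condition above and is fixed by convention: the transformation matrix across the third branch, in this direction, is $E_{31}(-1)$. *)

(* Defs.v *)
From HB Require Import structures.
From mathcomp Require Import all_boot all_order all_algebra all_fingroup.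
From mathcomp Require Import generic_quotient ring_quotient complex.
From mathcomp Require Import all_classical all_reals all_analysis.

Set Implicit Arguments.
Unset Strict Implicit.
Unset Printing Implicit Defensive.

Import Order.TTheory GRing.Theory Num.Theory numFieldNormedType.Exports.

Local Open Scope classical_set_scope.
Local Open Scope ring_scope.
Local Open Scope quotient_scope.

(** * Plane curves *)

(* Closed curves are parametrized by the line, with period 1. *)
Definition simple_loop (R : realType) (c : R -> 'rV[R]_2) : Prop :=
  [/\ continuous c,
      forall t, c (t + 1) = c t &
      {in `[0, 1[%R &, injective c}].

Definition inside_curve (R : realType) (A : set 'rV[R]_2) : set 'rV[R]_2 :=
  [set x | ~ A x /\ bounded_set (connected_component (~` A) x)].

(* The cusps are ordinary ones: the curve is singular there, with independent
   second and third derivatives; the three sides are immersed. *)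
Definition tricuspoid (R : realType) (A : set 'rV[R]_2) : Prop :=
  exists c : R -> 'rV[R]_2,
    [/\ simple_loop c,
        forall k (t : R), derivable (derive1n k c) t 1,
        A = range c &
        exists t1 t2 t3 : R,
          [/\ 0 <= t1, t1 < t2, t2 < t3, t3 < 1 &
          [/\ forall t : R, 0 <= t < 1 ->
                (derive1n 1 c t = 0 <-> [\/ t = t1, t = t2 | t = t3]) &
              forall t, [\/ t = t1, t = t2 | t = t3] ->
                row_free (col_mx (derive1n 2 c t) (derive1n 3 c t))]]].

(** * The gradient system *)

Definition partial (R : realType) (i : 'I_2) (g : 'rV[R]_2 -> R)
    : 'rV[R]_2 -> R :=
  fun y => 'D_(delta_mx 0 i) g y.

Definition smooth (R : realType) (g : 'rV[R]_2 -> R) : Prop :=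
  forall l : seq 'I_2, let h := foldr (@partial R) g l in
    continuous h /\ forall i y, derivable h y (delta_mx 0 i).

Definition gradient (R : realType) (g : 'rV[R]_2 -> R) (y : 'rV[R]_2)
    : 'rV[R]_2 :=
  \row_i partial i g y.

Definition hessian (R : realType) (g : 'rV[R]_2 -> R) (y : 'rV[R]_2)
    : 'M[R]_2 :=
  \matrix_(i, j) partial i (partial j g) y.

Definition elliptic_umbilic (R : realType) (y : 'rV[R]_2) : R :=
  3^-1 * y 0 0 ^+ 3 - y 0 0 * y 0 1 ^+ 2.

Definition tilt (R : realType) (ft : 'rV[R]_2 -> R) (x y : 'rV[R]_2) : R :=
  ft y - \sum_i x 0 i * y 0 i.

Definition critical (R : realType) (g : 'rV[R]_2 -> R) (y : 'rV[R]_2) : Prop :=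
  gradient g y = 0.

Definition degenerate (R : realType) (g : 'rV[R]_2 -> R) (y : 'rV[R]_2)
    : Prop :=
  \det (hessian g y) = 0.

Definition caustic (R : realType) (ft : 'rV[R]_2 -> R) : set 'rV[R]_2 :=
  [set x | exists y, critical (tilt ft x) y /\ degenerate (tilt ft x) y].

(* [o] fixes the time orientation of the gradient lines, so that
   "from a to b" and "index" always refer to the field
   (-1) ^+ o *: gradient.  The gradient system dy/dt = gradient, with the
   dimension of the unstable manifold as index, is [o = false]; the usual
   Morse index (number of negative eigenvalues of the hessian), with lines
   going down the function, is [o = true].  A perturbation whose node is a
   minimum (resp. maximum) has a node of index 2 for the former (resp. the
   latter). *)
Definition morse_index (R : realType) (o : bool) (g : 'rV[R]_2 -> R)
    (y : 'rV[R]_2) (k : nat) : Prop :=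
  exists l : 'I_2 -> R,
    char_poly (hessian g y) = \prod_i ('X - (l i)%:P) /\
    #|[set i | (0 < (-1) ^+ o * l i)%R]%SET| = k.

Definition nondeg_critical (R : realType) (o : bool) (k : nat)
    (g : 'rV[R]_2 -> R) (y : 'rV[R]_2) : Prop :=
  [/\ critical g y, ~ degenerate g y & morse_index o g y k].

Definition saddle (R : realType) (o : bool) (g : 'rV[R]_2 -> R) (y : 'rV[R]_2)
    : Prop :=
  nondeg_critical o 1 g y.

Definition gradient_line (R : realType) (o : bool) (g : 'rV[R]_2 -> R)
    (a b : 'rV[R]_2) : Prop :=
  exists c : R -> 'rV[R]_2,
    [/\ forall t : R, is_derive t 1 c ((-1) ^+ o *: gradient g (c t)),
        c t @[t --> -oo] --> a &
        c t @[t --> +oo] --> b].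

Definition bifurcation_locus (R : realType) (o : bool) (ft : 'rV[R]_2 -> R)
    : set 'rV[R]_2 :=
  [set x | ~ caustic ft x /\
     exists a b, [/\ saddle o (tilt ft x) a, saddle o (tilt ft x) b, a <> b &
                     gradient_line o (tilt ft x) a b]].

Definition inside_caustic (R : realType) (ft : 'rV[R]_2 -> R)
    : set 'rV[R]_2 :=
  inside_curve (caustic ft).

(** * Incidence matrices and Morse homology *)

Definition incidence (R : realType) (o : bool) (ft : 'rV[R]_2 -> R)
    (s : 'I_3 -> 'rV[R]_2 -> 'rV[R]_2) (nd : 'rV[R]_2 -> 'rV[R]_2)
    (x : 'rV[R]_2) : 'cV[R[i]]_3 :=
  \col_j (`[< gradient_line o (tilt ft x) (nd x) (s j x) >])%:R.

(* The direct sum of the lines C[s_i] is the space of columns, and the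
   Morse differential of the node is the incidence column [a]. *)
Definition boundary (R : realType) (a : 'cV[R[i]]_3)
    : zmodClosed 'cV[R[i]]_3 :=
  GRing.ZmodClosed.clone _ (pred_of_vspace <[a]>%VS) _.

Definition fibre (R : realType) (a : 'cV[R[i]]_3) :=
  Quotient.quot (boundary a).

HB.instance Definition _ (R : realType) (a : 'cV[R[i]]_3) :=
  GRing.Zmodule.on (fibre a).
HB.instance Definition _ (R : realType) (a : 'cV[R[i]]_3) :=
  EqQuotient.on (fibre a).

Lemma fibre_eqP (R : realType) (a u v : 'cV[R[i]]_3) :
  reflect (\pi_(fibre a) u = \pi_(fibre a) v) (u - v \in <[a]>%VS).
Proof.
rewrite (_ : (u - v \in _) = (u == v %[mod fibre a])); first exact: eqP.
exact: (Quotient.idealrBE (boundary a) u v).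
Qed.

Definition fibre_scale (R : realType) (a : 'cV[R[i]]_3) (z : R[i])
    (e : fibre a) : fibre a :=
  \pi_(fibre a) (z *: repr e).

Lemma fibre_scale_pi (R : realType) (a v : 'cV[R[i]]_3) (z : R[i]) :
  fibre_scale z (\pi_(fibre a) v) = \pi_(fibre a) (z *: v).
Proof.
apply/fibre_eqP; rewrite -scalerBr; apply: memvZ.
by apply/fibre_eqP; rewrite reprK.
Qed.

Lemma fibre_lmod (R : realType) (a : 'cV[R[i]]_3) :
  let sc := @fibre_scale R a in
  [/\ forall x y e, sc x (sc y e) = sc (x * y) e, left_id 1 sc,
      right_distributive sc +%R &
      forall e, {morph sc^~ e : x y / x + y >-> x + y}].
Proof.
have piD u v : \pi_(fibre a) u + \pi_(fibre a) v = \pi_(fibre a) (u + v).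
  by rewrite raddfD.
rewrite /=; split.
- move=> x y; elim/quotW=> v.
  by rewrite (fibre_scale_pi a v y) !fibre_scale_pi scalerA.
- by elim/quotW=> v; rewrite fibre_scale_pi scale1r.
- move=> x; elim/quotW=> v; elim/quotW=> w.
  by rewrite piD !(fibre_scale_pi a _ x) piD scalerDr.
- elim/quotW=> v x y.
  by rewrite /= !(fibre_scale_pi a v) piD scalerDl.
Qed.

HB.instance Definition _ (R : realType) (a : 'cV[R[i]]_3) :=
  GRing.Zmodule_isLmodule.Build R[i] (fibre a)
    (let: And4 h _ _ _ := fibre_lmod a in h)
    (let: And4 _ h _ _ := fibre_lmod a in h)
    (let: And4 _ _ h _ := fibre_lmod a in h)
    (let: And4 _ _ _ h := fibre_lmod a in h).

(* The map induced on the homologies by a matrix [M] with M a in C b. *)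
Definition glue (R : realType) (M : 'M[R[i]]_3) (a b : 'cV[R[i]]_3)
    (e : fibre a) : fibre b :=
  \pi_(fibre b) (M *m repr e).

Lemma glue_pi (R : realType) (M : 'M[R[i]]_3) (a b v : 'cV[R[i]]_3) :
  M *m a \in <[b]>%VS -> glue M b (\pi_(fibre a) v) = \pi_(fibre b) (M *m v).
Proof.
move=> Mab; apply/fibre_eqP; rewrite -mulmxBr.
have /fibre_eqP/vlineP[c ->] :
  \pi_(fibre a) (repr (\pi_(fibre a) v)) = \pi_(fibre a) v by rewrite reprK.
by rewrite -scalemxAr memvZ.
Qed.

Definition elem_mx (R : realType) (i j : 'I_3) (tau : R[i]) : 'M[R[i]]_3 :=
  1%:M + tau *: delta_mx i j.

(** * Cyclic words of regions and branches *)

(* A loop that meets the bifurcation locus in successive points is recorded by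
   the list of the pairs (a, (i, j)): the incidence of the region left at the
   crossing, and the labels of a gradient line from s_i to s_j that is present
   at the crossing.  The region entered is the one left at the cyclically next
   crossing. *)
Definition cword (R : realType) := seq ('cV[R[i]]_3 * ('I_3 * 'I_3)).

(* The regions a_0, a_1, ..., a_(k-1) and the branches b_0, ..., b_(k-1)
   become a_0, a_(k-1), ..., a_1 and b_(k-1), ..., b_0. *)
Definition orient (R : realType) (o : bool) (w : cword R) : cword R :=
  if o then zip (rotr 1 (rev (unzip1 w))) (rev (unzip2 w)) else w.

Definition orient_mx (R : realType) (o : bool) (Ms : seq 'M[R[i]]_3) :=
  if o then map invmx (rev Ms) else Ms.

Definition relabel (R : realType) (sg : 'S_3)
    (c : 'cV[R[i]]_3 * ('I_3 * 'I_3)) : 'cV[R[i]]_3 * ('I_3 * 'I_3) :=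
  (row_perm sg^-1%g c.1, (sg c.2.1, sg c.2.2)).

Definition lab1 : 'I_3 := @Ordinal 3 0 isT.
Definition lab2 : 'I_3 := @Ordinal 3 1 isT.
Definition lab3 : 'I_3 := @Ordinal 3 2 isT.

Definition col3 (R : realType) (a b c : nat) : 'cV[R[i]]_3 :=
  \col_j (nth 0 [:: a; b; c] j)%:R.

Definition type_a (R : realType) (w : cword R) : Prop :=
  exists (a a' : 'cV[R[i]]_3) (i j : 'I_3),
    [/\ i != j, a j 0 = 0, a' j 0 = 1, forall l, l != j -> a l 0 = a' l 0 &
        w = [:: (a, (i, j)); (a', (i, j)); (a, (i, j)); (a', (i, j))]].

Definition word_b (R : realType) : cword R :=
  [:: (col3 R 1 1 1, (lab2, lab1)); (col3 R 0 1 1, (lab2, lab3));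
      (col3 R 0 1 0, (lab2, lab1)); (col3 R 1 1 0, (lab2, lab3))].

Definition word_c (R : realType) : cword R :=
  [:: (col3 R 1 1 1, (lab2, lab1)); (col3 R 0 1 1, (lab2, lab3));
      (col3 R 0 1 0, (lab1, lab3)); (col3 R 0 1 0, (lab2, lab1));
      (col3 R 1 1 0, (lab1, lab3))].

(* [r] is the starting region. *)
Definition classified (R : realType) (w : cword R) : Prop :=
  exists (r : nat) (o : bool), let w' := orient o (rot r w) in
    [\/ type_a w',
        exists sg, w' = map (relabel sg) (word_b R) |
        exists sg, w' = map (relabel sg) (word_c R)].

Definition third_branch_convention (R : realType) (w : cword R)
    (Ms : seq 'M[R[i]]_3) : Prop :=
  forall (r : nat) (o : bool) (sg : 'S_3),
    orient o (rot r w) = map (relabel sg) (word_c R) ->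
    nth 0 (orient_mx o (rot r Ms)) 2 = elem_mx (sg lab3) (sg lab1) (-1).

(** * Intersection points and small loops *)

(* [k] branches of [B] leave [p]; they run in [N] up to their ends, which are
   not in [N], and [N] contains no other point of [B]. *)
Record branch_nbhd (R : realType) (B : set 'rV[R]_2) (p : 'rV[R]_2)
    (N : set 'rV[R]_2) (k : nat) (br : 'I_k -> R -> 'rV[R]_2) : Prop := {
  bn_open : open N;
  bn_continuous : forall m, {within `[0, 1], continuous (br m)};
  bn_injective : forall m, {in `[0, 1]%R &, injective (br m)};
  bn_start : forall m, br m 0 = p;
  bn_in : forall m (t : R), 0 <= t < 1 -> N (br m t);
  bn_end : forall m, ~ N (br m 1);
  bn_disjoint : forall m m' (t t' : R), 0 <= t < 1 -> 0 <= t' < 1 ->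
    br m t = br m' t' -> m = m' \/ t = 0 /\ t' = 0;
  bn_locus : N `&` B = \bigcup_m (br m @` `[0, 1[)
}.

(* A point where [B] is locally a single line has exactly two branches; at
   least three leave a point where bifurcation lines meet. *)
Definition intersection_point (R : realType) (B : set 'rV[R]_2)
    (p : 'rV[R]_2) : Prop :=
  exists (k : nat) (N : set 'rV[R]_2) (br : 'I_k -> R -> 'rV[R]_2),
    (3 <= k)%N /\ branch_nbhd B p N br.

(* A simple loop around [p], in [N] together with its inside, that meets each
   branch exactly once (hence crosses it, since the branch starts inside the
   loop and ends outside). *)
Definition small_loop (R : realType) (p : 'rV[R]_2) (N : set 'rV[R]_2)
    (k : nat) (br : 'I_k -> R -> 'rV[R]_2) (c : R -> 'rV[R]_2) : Prop :=
  [/\ simple_loop c, range c `<=` N, inside_curve (range c) p,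
      inside_curve (range c) `<=` N &
      forall m, exists! t : R, 0 <= t < 1 /\ (br m @` `[0, 1[) (c t)].

(* The loop [c], based at a point that is not in [B], meets [B] at the times
   [t m], [m < k]; the points [c (u m)] are in the successive regions. *)
Definition crossing_times (R : realType) (B : set 'rV[R]_2)
    (c : R -> 'rV[R]_2) (k : nat) (t u : nat -> R) : Prop :=
  [/\ u 0%N = 0, u k = 1,
      forall m, (m < k)%N -> u m < t m < u m.+1 &
      forall z : R, 0 <= z <= 1 ->
        (B (c z) <-> exists2 m, (m < k)%N & z = t m)].

Definition crossing_labels (R : realType) (o : bool) (ft : 'rV[R]_2 -> R)
    (s : 'I_3 -> 'rV[R]_2 -> 'rV[R]_2) (c : R -> 'rV[R]_2) (k : nat)
    (t : nat -> R) (b : nat -> 'I_3 * 'I_3) : Prop :=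
  forall m, (m < k)%N -> let x := c (t m) in
    (b m).1 != (b m).2 /\
    gradient_line o (tilt ft x) (s (b m).1 x) (s (b m).2 x).

Definition small_crossing_loop (R : realType) (o : bool) (ft : 'rV[R]_2 -> R)
    (s : 'I_3 -> 'rV[R]_2 -> 'rV[R]_2) (p : 'rV[R]_2) (c : R -> 'rV[R]_2)
    (k : nat) (t u : nat -> R) (b : nat -> 'I_3 * 'I_3) : Prop :=
  exists (N : set 'rV[R]_2) (br : 'I_k -> R -> 'rV[R]_2),
    let B := bifurcation_locus o ft in
    [/\ N `<=` inside_caustic ft, branch_nbhd B p N br, small_loop p N br c,
        crossing_times B c k t u & crossing_labels o ft s c k t b].

Definition loop_word (R : realType) (o : bool) (ft : 'rV[R]_2 -> R)
    (s : 'I_3 -> 'rV[R]_2 -> 'rV[R]_2) (nd : 'rV[R]_2 -> 'rV[R]_2)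
    (c : R -> 'rV[R]_2) (k : nat) (u : nat -> R) (b : nat -> 'I_3 * 'I_3)
    : cword R :=
  mkseq (fun m => (incidence o ft s nd (c (u m)), b m)) k.

(** * Generic small perturbations *)

(* Smallness and genericity are expressed by the facts that they are known to
   give. *)
Record generic_perturbation (R : realType) (o : bool) (ft : 'rV[R]_2 -> R)
    (s : 'I_3 -> 'rV[R]_2 -> 'rV[R]_2) (nd : 'rV[R]_2 -> 'rV[R]_2)
    : Prop := {
  gp_smooth : smooth ft;
  gp_compact : exists2 A : set 'rV[R]_2, compact A &
    forall y, ~ A y -> ft y = elliptic_umbilic y;
  gp_caustic : tricuspoid (caustic ft);
  gp_critical : forall x, inside_caustic ft x -> forall y,
    critical (tilt ft x) y <-> y = nd x \/ exists i, y = s i x;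
  gp_saddle : forall x, inside_caustic ft x ->
    injective (fun i => s i x) /\ forall i, saddle o (tilt ft x) (s i x);
  gp_node : forall x, inside_caustic ft x ->
    nondeg_critical o 2 (tilt ft x) (nd x);
  gp_saddle_cont : forall i, {within inside_caustic ft, continuous (s i)};
  gp_node_cont : {within inside_caustic ft, continuous nd};
  gp_incidence : forall x y, inside_caustic ft x ->
    connected_component (~` (caustic ft `|` bifurcation_locus o ft)) x y ->
    incidence o ft s nd y = incidence o ft s nd x;
  gp_inside : forall p, intersection_point (bifurcation_locus o ft) p ->
    inside_caustic ft p;
  gp_classification : forall p,
    intersection_point (bifurcation_locus o ft) p ->
    forall c k t u b, small_crossing_loop o ft s p c k t u b ->
      classified (loop_word o ft s nd c k u b)
}.

(** * Gluing around an intersection point *)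

Definition transformation_matrices (R : realType) (o : bool)
    (ft : 'rV[R]_2 -> R) (s : 'I_3 -> 'rV[R]_2 -> 'rV[R]_2)
    (nd : 'rV[R]_2 -> 'rV[R]_2) (c : R -> 'rV[R]_2) (k : nat) (u : nat -> R)
    (b : nat -> 'I_3 * 'I_3) (M : nat -> 'M[R[i]]_3) : Prop :=
  (forall m, (m < k)%N -> exists2 tau : R[i], tau \in [:: 1; 0; -1] &
     M m = elem_mx (b m).2 (b m).1 tau /\
     M m *m incidence o ft s nd (c (u m)) = incidence o ft s nd (c (u m.+1)))
  /\ third_branch_convention (loop_word o ft s nd c k u b) (mkseq M k).

(* The composition of the gluings by the matrices of [l], each given with the
   incidence of the region that is entered.  The last step is the
   trivialization over the component where the path ends. *)
Fixpoint transport (R : realType) (a b : 'cV[R[i]]_3)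
    (l : seq ('M[R[i]]_3 * 'cV[R[i]]_3)) : fibre a -> fibre b :=
  match l with
  | [::] => fun e => glue 1%:M b e
  | (M, a') :: l' => fun e => transport b l' (glue M a' e)
  end.

Definition loop_gluing (R : realType) (o : bool) (ft : 'rV[R]_2 -> R)
    (s : 'I_3 -> 'rV[R]_2 -> 'rV[R]_2) (nd : 'rV[R]_2 -> 'rV[R]_2)
    (c : R -> 'rV[R]_2) (k : nat) (u : nat -> R) (M : nat -> 'M[R[i]]_3)
    : fibre (incidence o ft s nd (c 0)) -> fibre (incidence o ft s nd (c 0)) :=
  transport (incidence o ft s nd (c 0))
    (mkseq (fun m => (M m, incidence o ft s nd (c (u m.+1)))) k).

Definition extends_through (R : realType) (o : bool) (ft : 'rV[R]_2 -> R)
    (s : 'I_3 -> 'rV[R]_2 -> 'rV[R]_2) (nd : 'rV[R]_2 -> 'rV[R]_2)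
    (p : 'rV[R]_2) : Prop :=
  forall c k t u b M, small_crossing_loop o ft s p c k t u b ->
    transformation_matrices o ft s nd c k u b M ->
    forall e, @loop_gluing R o ft s nd c k u M e = e.

(* Main.v *)
Require Import Defs.
From mathcomp Require Import all_boot all_order all_algebra.
From mathcomp Require Import all_classical all_reals all_analysis.
From mathcomp Require Import all_fingroup generic_quotient complex.

(** Around an intersection point the product of the transformation matrices is
    the identity already on the direct sum of the three saddle lines, hence
    also on the homology.  Every transformation matrix is elementary, so the
    claim is one relation between elementary matrices for each type of point.

    The parameters of these matrices are forced by the incidence columns: the
    matrix of a line from s_i to s_j sends a to a' only if
    tau * a_i = a'_j - a_j, and a_i = 1 at every crossing that occurs except
    at the third branch of type (c), where a_i = 0 and the convention gives
    tau = -1.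
    - In type (a) the four matrices lie in one root subgroup, and their
      parameters alternate in sign, so they cancel.
    - In type (b) the product is the commutator of E_32(1) and E_12(1), which
      commute because both lines start at the same saddle
      ([elem_mx_commutator]).
    - In type (c) it is
      E_31(1) E_12(1) E_31(-1) E_32(-1) E_12(-1) = 1, the Steinberg relation
      between E_31 and E_12, whose commutator is E_32 ([elem_mx_relator]).

    The classification holds only up to the base region, the orientation of
    the loop and the labels of the saddles.  Changing the base region replaces
    the product of the matrices by a conjugate and reversing the loop by the
    inverse, so being the identity does not depend on either
    ([holonomy_rot], [lap_orient]); the relations above hold for arbitrary
    distinct labels. *)

Set Implicit Arguments.
Unset Strict Implicit.
Unset Printing Implicit Defensive.

Import GRing.Theory.

Local Open Scope ring_scope.
Local Open Scope quotient_scope.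

(** * Elementary matrices *)

Lemma elem_mx_mulE (R : realType) (j i : 'I_3) (t : R[i]) (a : 'cV_3) l :
  (elem_mx j i t *m a) l 0 = a l 0 + t * (a i 0 *+ (l == j)).
Proof.
rewrite mulmxDl mul1mx -scalemxAl !mxE (bigD1 i) //= !mxE eqxx andbT.
rewrite big1 ?addr0; first by rewrite mulr_natl.
by move=> m /negPf mi; rewrite !mxE mi andbF mul0r.
Qed.

Lemma elem_mx_entry (R : realType) (j i : 'I_3) (t : R[i]) :
  i != j -> elem_mx j i t j i = t.
Proof.
by move=> /negPf ij; rewrite !mxE eq_sym ij !eqxx mulr1 add0r.
Qed.

Lemma elem_mx0 (R : realType) (j i : 'I_3) : elem_mx j i (0 : R[i]) = 1.
Proof. by rewrite /elem_mx scale0r addr0. Qed.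

Lemma elem_mx_mul (R : realType) (j i l m : 'I_3) (s t : R[i]) :
  elem_mx j i s * elem_mx l m t =
  1 + s *: delta_mx j i + t *: delta_mx l m
    + (s * t) *: (delta_mx j m *+ (i == l)).
Proof.
rewrite /elem_mx -[1%:M]/(1 : 'M[R[i]]_3) mulrDl mul1r mulrDr mulr1.
rewrite -scalerAl -scalerAr scalerA.
rewrite -[delta_mx j i * _]/(delta_mx j i *m delta_mx l m).
rewrite mul_delta_mx_cond !addrA; congr (_ + _).
by rewrite -!addrA; congr (_ + _); rewrite addrC.
Qed.

Lemma elem_mxD (R : realType) (j i : 'I_3) (s t : R[i]) : i != j ->
  elem_mx j i s * elem_mx j i t = elem_mx j i (s + t).
Proof.
move=> /negPf ij; rewrite elem_mx_mul ij scaler0 addr0 -addrA -scalerDl.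
by [].
Qed.

Lemma elem_mxNK (R : realType) (j i : 'I_3) (t : R[i]) : i != j ->
  elem_mx j i (- t) * elem_mx j i t = 1.
Proof. by move=> ij; rewrite elem_mxD // addNr elem_mx0. Qed.

Lemma elem_mxKN (R : realType) (j i : 'I_3) (t : R[i]) : i != j ->
  elem_mx j i t * elem_mx j i (- t) = 1.
Proof. by move=> ij; rewrite elem_mxD // subrr elem_mx0. Qed.

Lemma elem_mxK (R : realType) (j i : 'I_3) (t : R[i])
    (M : 'M[R[i]]_3) : i != j ->
  M * elem_mx j i t * elem_mx j i (- t) = M.
Proof. by move=> ij; rewrite -mulrA elem_mxKN // mulr1. Qed.

Lemma elem_mxV (R : realType) (j i : 'I_3) (t : R[i]) : i != j ->
  invmx (elem_mx j i t) = elem_mx j i (- t).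
Proof.
move=> ij; rewrite -[invmx _]/((elem_mx j i t)^-1).
have U : elem_mx j i t \is a GRing.unit.
  by apply/unitrP; exists (elem_mx j i (- t)); rewrite elem_mxNK ?elem_mxKN.
by rewrite -[LHS]mul1r -(elem_mxNK t ij) mulrK.
Qed.

Lemma elem_mxC (R : realType) (j i l m : 'I_3) (s t : R[i]) :
  i != l -> m != j ->
  elem_mx j i s * elem_mx l m t = elem_mx l m t * elem_mx j i s.
Proof.
move=> /negPf il /negPf mj; rewrite !elem_mx_mul il mj !scaler0 !addr0.
by rewrite addrAC.
Qed.

(** The noncommuting case: a row operation with source p does not commute with
    one whose target is p, and the defect is the composite row operation. *)
Lemma elem_mx_steinberg (R : realType) (r p q : 'I_3) (s t : R[i]) :
  q != r ->
  elem_mx r p t * elem_mx p q s =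
  elem_mx p q s * (elem_mx r q (t * s) * elem_mx r p t).
Proof.
move=> /negPf qr.
rewrite [in RHS]elem_mx_mul qr scaler0 addr0 elem_mx_mul eqxx mulr1n.
rewrite /elem_mx -[1%:M]/(1 : 'M[R[i]]_3) mulrDl mul1r !mulrDr mulr1.
rewrite -!scalerAl -!scalerAr.
rewrite -[delta_mx p q * delta_mx r q]/(delta_mx p q *m delta_mx r q).
rewrite -[delta_mx p q * delta_mx r p]/(delta_mx p q *m delta_mx r p).
rewrite !mul_delta_mx_cond qr !scaler0 !addr0 -!addrA; congr (_ + _).
by rewrite addrA addrC.
Qed.

(** The Steinberg relation in the order of the crossings of type (c), where
    (p, q, r) stands for (1, 2, 3): the E_rp produced by the exchange cancels
    the third matrix, and the rest telescopes. *)
Lemma elem_mx_relator (R : realType) (r p q : 'I_3) (s t : R[i]) :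
  p != r -> q != r -> q != p ->
  elem_mx r p t * elem_mx p q s * elem_mx r p (- t) *
    elem_mx r q (- (t * s)) * elem_mx p q (- s) = 1.
Proof.
move=> pr qr qp; rewrite elem_mx_steinberg // mulrA.
rewrite (elem_mxK t _ pr) (elem_mxK (t * s) _ qr); exact: elem_mxKN.
Qed.

Lemma elem_mx_commutator (R : realType) (j l i : 'I_3) (s t : R[i]) :
  i != j -> i != l ->
  elem_mx l i t * elem_mx j i s * elem_mx l i (- t) * elem_mx j i (- s) = 1.
Proof.
move=> ij il; rewrite (elem_mxC t s ij il) (elem_mxK t _ il).
exact: elem_mxKN.
Qed.

(** * Transport along a word of matrices *)

Lemma map_iota1 (T : Type) (F : nat -> T) (k : nat) :
  map F (iota 1 k) = mkseq (F \o S) k.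
Proof. by rewrite /mkseq (iotaDl 1 0) -map_comp. Qed.

Lemma rot1_mkseq (T : Type) (F : nat -> T) (k : nat) :
  F k = F 0%N -> rot 1 (mkseq F k) = mkseq (F \o S) k.
Proof.
case: k => [//|k] Fk.
by rewrite [RHS]mkseqS [(F \o S) k]/= Fk -map_iota1 -rot1_cons.
Qed.

(** The matrices are listed in the order in which they are crossed, so the last
    one is the leftmost factor. *)
Fixpoint holonomy (R : realType) (Ms : seq 'M[R[i]]_3) : 'M[R[i]]_3 :=
  if Ms is M :: Ms' then holonomy Ms' * M else 1.

Lemma holonomy_cat (R : realType) (s1 s2 : seq 'M[R[i]]_3) :
  holonomy (s1 ++ s2) = holonomy s2 * holonomy s1.
Proof. by elim: s1 => [|M s1 /= ->]; rewrite ?mulr1 ?mulrA. Qed.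

(** Moving the base point conjugates the holonomy; for square matrices,
    X Y = 1 forces Y X = 1. *)
Lemma holonomy_rot (R : realType) r (Ms : seq 'M[R[i]]_3) :
  holonomy (rot r Ms) = 1 -> holonomy Ms = 1.
Proof.
rewrite /rot -{3}[Ms](cat_take_drop r) !holonomy_cat; exact: mulmx1C.
Qed.

(** Each gluing is well defined on the quotients because its matrix carries the
    incidence column of the region left to that of the region entered;
    therefore the composite is induced by the product of the matrices. *)
Lemma transport_pi (R : realType) (k : nat) (A : nat -> 'cV[R[i]]_3)
    (M : nat -> 'M[R[i]]_3) (a b v : 'cV[R[i]]_3) :
  (forall m, (m < k)%N -> M m *m A m = A m.+1) -> A 0%N = a -> A k = b ->
  transport b (mkseq (fun m => (M m, A m.+1)) k) (\pi_(fibre a) v) =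
  \pi_(fibre b) (holonomy (mkseq M k) *m v).
Proof.
elim: k A M a v => [|k IH] A M _ v MA <- Ab /=.
  by rewrite glue_pi ?Ab // mul1mx memv_line.
rewrite glue_pi ?MA ?memv_line // !map_iota1.
rewrite (IH (A \o S) (M \o S)) //; last by move=> m mk; apply: MA.
by rewrite mulmxA.
Qed.

(** * Laps *)

(** A letter of a word of regions and branches, with the parameter tau of the
    transformation matrix.  The region entered is computed from these data
    instead of being read off the next letter, so that one crossing can be
    reversed on its own. *)
Definition crossing (R : realType) : Type :=
  (('cV[R[i]]_3 * ('I_3 * 'I_3)) * R[i])%type.

Definition crossing_mx (R : realType) (q : crossing R) : 'M[R[i]]_3 :=
  elem_mx q.1.2.2 q.1.2.1 q.2.

Definition entered (R : realType) (q : crossing R) : 'cV[R[i]]_3 :=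
  crossing_mx q *m q.1.1.

Definition back (R : realType) (q : crossing R) : crossing R :=
  ((entered q, q.1.2), - q.2).

(** The crossings fit together cyclically: what each one enters is what the
    cyclically next one leaves. *)
Definition lap (R : realType) (L : seq (crossing R)) : Prop :=
  all (fun q => q.1.2.1 != q.1.2.2) L /\
  map (@entered R) L = rot 1 (unzip1 (unzip1 L)).

Lemma crossing_mx_back (R : realType) (q : crossing R) :
  q.1.2.1 != q.1.2.2 -> crossing_mx (back q) = invmx (crossing_mx q).
Proof. by move=> q12; rewrite /crossing_mx elem_mxV. Qed.

Lemma entered_back (R : realType) (q : crossing R) :
  q.1.2.1 != q.1.2.2 -> entered (back q) = q.1.1.
Proof.
move=> q12; rewrite /entered /= mulmxA.
rewrite -[crossing_mx (back q) *m _]/(crossing_mx (back q) * crossing_mx q).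
by rewrite elem_mxNK // mul1mx.
Qed.

Lemma lap_rot (R : realType) r (L : seq (crossing R)) :
  lap L -> lap (rot r L).
Proof.
case=> L12 Lcl; split.
  by rewrite /rot all_cat andbC -all_cat cat_take_drop.
by rewrite map_rot Lcl /unzip1 !map_rot rot_rot.
Qed.

(** Reversal turns the regions entered into the regions left, that is, into the
    rotated list of the latter; this shift by one is the [rotr 1] in
    [orient]. *)
Lemma lap_back (R : realType) (L : seq (crossing R)) :
  lap L -> lap (rev (map (@back R) L)).
Proof.
case=> L12 Lcl; split; first by rewrite all_rev all_map.
rewrite /unzip1 !map_rev -!map_comp.
rewrite -[X in rot 1 (rev X)]/(map (@entered R) L) Lcl rev_rot rotrK.
rewrite /unzip1 -map_comp; congr rev.
by apply/eq_in_map => q /(allP L12); apply: entered_back.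
Qed.

(** The reverse lap has the inverse holonomy, so triviality may be checked in
    whichever direction the classification applies to. *)
Lemma lap_orient (R : realType) (o : bool) (L : seq (crossing R)) :
  lap L -> exists L' : seq (crossing R),
    [/\ lap L', unzip1 L' = orient o (unzip1 L),
        map (@crossing_mx R) L' = orient_mx o (map (@crossing_mx R) L) &
        holonomy (map (@crossing_mx R) L') = 1 ->
        holonomy (map (@crossing_mx R) L) = 1].
Proof.
case: o => lapL; last by exists L.
case: (lapL) => L12 Lcl.
exists (rev (map (@back R) L)); split.
- exact: lap_back.
- rewrite /= -rev_rot -Lcl -rev_zip ?size_map //.
  rewrite /unzip1 /unzip2 map_rev -!map_comp; congr rev.
  by elim: (L) => //= q L' ->.
- rewrite /= map_rev -map_comp -map_rev -[in RHS]map_rev -map_comp.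
  apply/eq_in_map => q; rewrite mem_rev => /(allP L12).
  exact: crossing_mx_back.
- have LV : holonomy (map (@crossing_mx R) L) *
      holonomy (map (@crossing_mx R) (rev (map (@back R) L))) = 1.
    elim: (L) L12 => [|q L' IH] /=; first by rewrite mulr1.
    case/andP=> q12 /IH IHL'; rewrite rev_cons map_rcons -cats1.
    rewrite holonomy_cat /= mul1r mulrA -[_ * _ * crossing_mx (back q)]mulrA.
    by rewrite elem_mxKN // mulr1.
  by move=> h; move: LV; rewrite h mulr1.
Qed.

(** * The three types of intersection points *)

(** The parameter of a crossing changes only the target entry, where the source
    entry multiplies it; this is how incidence columns determine tau. *)
Lemma entered_target (R : realType) (q : crossing R) :
  entered q q.1.2.2 0 = q.1.1 q.1.2.2 0 + q.2 * q.1.1 q.1.2.1 0.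
Proof. by rewrite elem_mx_mulE eqxx mulr1n. Qed.

(** The source entry a_i is the same in all four regions, so creation gives
    t * a_i = 1 and destruction gives t * a_i = -1; the parameters add up to
    zero after division by a_i. *)
Lemma holonomy_type_a (R : realType) (L : seq (crossing R)) :
  lap L -> type_a (unzip1 L) -> holonomy (map (@crossing_mx R) L) = 1.
Proof.
case=> _ Lcl [a [a' [i [j [ij aj a'j aa']]]]].
case: L Lcl => [|[c1 t1] [|[c2 t2] [|[c3 t3] [|[c4 t4] []]]]] //= Lcl.
case=> e1 e2 e3 e4; move: Lcl; rewrite {c1}e1 {c2}e2 {c3}e3 {c4}e4.
have ai : a i 0 = a' i 0 := aa' i ij.
case=> /(congr1 (fun v : 'cV_3 => v j 0)); rewrite entered_target /= => E1.
move=> /(congr1 (fun v : 'cV_3 => v j 0)); rewrite entered_target /= => E2.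
move=> /(congr1 (fun v : 'cV_3 => v j 0)); rewrite entered_target /= => E3.
move=> /(congr1 (fun v : 'cV_3 => v j 0)); rewrite entered_target /= => E4.
move: E1 E2 E3 E4; rewrite aj a'j -ai !add0r => E1 E2 E3 E4.
have ai0 : a i 0 != 0.
  by apply: contra_eq_neq E1 => ->; rewrite mulr0 eq_sym oner_eq0.
rewrite mul1r /crossing_mx /= !elem_mxD //.
suff -> : t4 + t3 + t2 + t1 = 0 by rewrite elem_mx0.
apply: (mulIf ai0); rewrite mul0r !mulrDl E1 E3.
by rewrite -addrA [t4 * _ + 1]addrC E4 add0r addrC E2.
Qed.

Lemma coef_relabel (R : realType) (sg : 'S_3) (a a' : 'cV[R[i]]_3)
    (b : 'I_3 * 'I_3) (t : R[i]) :
  entered (relabel sg (a, b), t) = row_perm sg^-1%g a' ->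
  t * a b.1 0 = a' b.2 0 - a b.2 0.
Proof.
move=> /(congr1 (fun v : 'cV_3 => v (sg b.2) 0)).
have := entered_target (relabel sg (a, b), t); rewrite /= => ->.
by rewrite !mxE !permK => <-; rewrite addrC addKr.
Qed.

Lemma holonomy_type_b (R : realType) (sg : 'S_3) (L : seq (crossing R)) :
  lap L -> unzip1 L = map (relabel sg) (word_b R) ->
  holonomy (map (@crossing_mx R) L) = 1.
Proof.
case=> _ Lcl.
case: L Lcl => [|[c1 t1] [|[c2 t2] [|[c3 t3] [|[c4 t4] []]]]] //= Lcl.
rewrite /rot /= in Lcl.
case=> e1 e2 e3 e4; rewrite {c1}e1 {c2}e2 {c3}e3 {c4}e4 in Lcl *.
case: Lcl => /coef_relabel + /coef_relabel + /coef_relabel + /coef_relabel.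
rewrite /= !mxE /= !mulr1 ?subrr ?sub0r ?subr0 => -> -> -> ->.
rewrite mul1r /crossing_mx /=.
have n21 : sg lab2 != sg lab1 by rewrite (inj_eq perm_inj).
have n23 : sg lab2 != sg lab3 by rewrite (inj_eq perm_inj).
exact: (elem_mx_commutator 1 1 n21 n23).
Qed.

Lemma holonomy_type_c (R : realType) (sg : 'S_3) (L : seq (crossing R)) :
  lap L -> unzip1 L = map (relabel sg) (word_c R) ->
  nth 0 (map (@crossing_mx R) L) 2 = elem_mx (sg lab3) (sg lab1) (-1) ->
  holonomy (map (@crossing_mx R) L) = 1.
Proof.
case=> _ Lcl.
case: L Lcl => [|[c1 t1] [|[c2 t2] [|[c3 t3] [|[c4 t4] [|[c5 t5] []]]]]] //=.
rewrite /rot /= => Lcl [e1 e2 e3 e4 e5].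
rewrite {c1}e1 {c2}e2 {c3}e3 {c4}e4 {c5}e5 in Lcl *.
(* The third crossing imposes nothing on t3, as its source entry is 0. *)
case: Lcl => /coef_relabel + /coef_relabel + _ /coef_relabel + /coef_relabel.
rewrite /= !mxE /= !mulr1 ?subrr ?sub0r ?subr0 => -> -> -> -> ->.
rewrite mul1r /crossing_mx /=.
have n21 : sg lab2 != sg lab1 by rewrite (inj_eq perm_inj).
have n23 : sg lab2 != sg lab3 by rewrite (inj_eq perm_inj).
have n13 : sg lab1 != sg lab3 by rewrite (inj_eq perm_inj).
by have := elem_mx_relator (1 : R[i]) 1 n13 n23 n21; rewrite mulr1.
Qed.

Lemma lap_holonomy (R : realType) (L : seq (crossing R)) :
  lap L -> classified (unzip1 L) ->
  third_branch_convention (unzip1 L) (map (@crossing_mx R) L) ->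
  holonomy (map (@crossing_mx R) L) = 1.
Proof.
move=> lapL [r]; case=> o wL conv.
have [L' [lapL' wL' ML' holL']] := lap_orient o (lap_rot r lapL).
apply: (@holonomy_rot _ r); rewrite -map_rot; apply: holL'.
rewrite /unzip1 map_rot in wL'.
case: wL; rewrite -wL'.
- exact: holonomy_type_a.
- by case=> sg; apply: holonomy_type_b.
- case=> sg wc; apply: (holonomy_type_c lapL' wc).
  by rewrite ML' map_rot; apply: conv; rewrite -wL'.
Qed.

Theorem proposition5p11 (R : realType) (o : bool)
    (ft : 'rV[R]_2 -> R) (s : 'I_3 -> 'rV[R]_2 -> 'rV[R]_2)
    (nd : 'rV[R]_2 -> 'rV[R]_2)
    (Hft : generic_perturbation o ft s nd)
    (p : 'rV[R]_2)
    (Hp : intersection_point (bifurcation_locus o ft) p) :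
  extends_through o ft s nd p.
Proof.
move=> c k t u b M loop [MI conv] e.
have wc := gp_classification Hft Hp loop.
case: (loop) => N [br [_ _ [[_ c1 _] _ _ _ _] [u0 uk _ _] lab]].
pose A m := incidence o ft s nd (c (u m)).
have A0 : A 0%N = incidence o ft s nd (c 0) by rewrite /A u0.
have Ak : A k = A 0%N by rewrite /A uk u0 -(c1 0) add0r; reflexivity.
(* tau is recovered from its matrix as the off-diagonal entry. *)
pose L : seq (crossing R) :=
  mkseq (fun m => ((A m, b m), M m (b m).2 (b m).1)) k.
have Mq m : (m < k)%N ->
    crossing_mx ((A m, b m), M m (b m).2 (b m).1) = M m.
  move=> mk; have [tau _ [Mm _]] := MI m mk.
  by rewrite /crossing_mx /= Mm (elem_mx_entry tau (proj1 (lab m mk))).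
have MA m : (m < k)%N -> M m *m A m = A m.+1 by case/MI => tau _ [].
have wL : unzip1 L = loop_word o ft s nd c k u b by rewrite /unzip1 -map_comp.
have ML : map (@crossing_mx R) L = mkseq M k.
  rewrite /L -map_comp; apply/eq_in_map => m.
  by rewrite mem_iota => /Mq.
have lapL : lap L.
  split.
    apply/allP => q /mapP[m]; rewrite mem_iota => /lab[mb _ ->].
    exact: mb.
  have -> : map (@entered R) L = mkseq (A \o S) k.
    rewrite /L -map_comp; apply/eq_in_map => m; rewrite mem_iota /= => mk.
    rewrite /entered (Mq m mk); exact: MA.
  have -> : unzip1 (unzip1 L) = mkseq A k by rewrite wL /unzip1 -map_comp.
  by rewrite rot1_mkseq.
have hol : holonomy (mkseq M k) = 1.
  by rewrite -ML; apply: lap_holonomy => //; rewrite wL ?ML.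
rewrite /loop_gluing -{1}[e]reprK.
rewrite (transport_pi _ MA A0 (etrans Ak A0)) hol mul1mx reprK.
by [].
Qed.
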